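(* There exists a sequence $(f_i)_{i\ge1}$ of distinct probability densities in $L^1([0,1])$ with the following two properties. (1) For each fixed $i$, if $(X_k)_{k\ge1}$ are independent random variables on $[0,1)$ each having density $f_i$, then the sum $X_1+\cdots+X_M$ modulo $1$ converges to the uniform distribution as $M\to\infty$. (2) If $(X_k)_{k\ge1}$ are independent random variables on $[0,1)$ with $X_k$ having density $f_k$ for every $k$, then the sum $X_1+\cdots+X_M$ modulo $1$ does not converge to the uniform distribution as $M\to\infty$.
   Context: Convergence of $X_1+\cdots+X_M \bmod 1$ to the uniform distribution means convergence in $L^1([0,1])$: if $h_M$ is the density of $X_1+\cdots+X_M\bmod 1$ on $[0,1)$, then $\lim_{M\to\infty}\int_0^1|h_M(x)-1|\,dx=0$. *)

(* Defs.v *)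
From HB Require Import structures.
From mathcomp Require Import all_boot all_order all_algebra.
From mathcomp Require Import finmap.
From mathcomp Require Import all_classical all_reals all_analysis.

Set Implicit Arguments.
Unset Strict Implicit.
Unset Printing Implicit Defensive.

Import Order.TTheory GRing.Theory Num.Theory.
Import numFieldNormedType.Exports.

Local Open Scope classical_set_scope.
Local Open Scope ring_scope.

(** Elements of L^1([0,1]) are represented by functions [R -> R], of which only
    the values on [0,1] matter; they are compared up to a.e. equality there. *)
Definition prob_density (R : realType) (f : R -> R) : Prop :=
  [/\ (@lebesgue_measure R).-integrable `[0, 1] (EFin \o f),
      (forall x, x \in `[0, 1] -> 0 <= f x) &
      (\int[@lebesgue_measure R]_(x in `[0%R, 1%R]) (f x)%:E = 1%:E)%E].

Definition same_L1 (R : realType) (f g : R -> R) : Prop :=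
  f = g %[ae (@lebesgue_measure R) in `[0, 1]%classic].

Definition has_density (R : realType) d (T : measurableType d)
    (P : probability T R) (Y : T -> R) (h : R -> R) : Prop :=
  prob_density h /\
  forall A : set R, measurable A ->
    (pushforward P Y A =
       \int[@lebesgue_measure R]_(x in A `&` `[0%R, 1%R[) (h x)%:E)%E.

Definition independent_RVs (R : realType) d (T : measurableType d)
    (P : probability T R) (X : nat -> {RV P >-> R}) : Prop :=
  forall (J : {fset nat}) (A : nat -> set R),
    (forall k, measurable (A k)) ->
    (P (\bigcap_(k in [set` J]) (X k @^-1` A k)) =
       \prod_(k <- J) P (X k @^-1` A k))%E.

(** Indices are shifted by one throughout: [X k] stands for X_(k+1), so this is
    X_1 + ... + X_M mod 1, with values in [0,1). *)
Definition sum_mod1 (R : realType) d (T : measurableType d)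
    (P : probability T R) (X : nat -> {RV P >-> R}) (M : nat) (t : T) : R :=
  let s := \sum_(k < M) X k t in s - (Num.floor s)%:~R.

(** [M = 0] is excluded: the empty sum has no density. *)
Definition cvg_to_uniform (R : realType) d (T : measurableType d)
    (P : probability T R) (X : nat -> {RV P >-> R}) : Prop :=
  exists h : nat -> R -> R,
    (forall M, (0 < M)%N -> has_density P (sum_mod1 X M) (h M)) /\
    (fun M => \int[@lebesgue_measure R]_(x in `[0%R, 1%R])
                (`|h M x - 1|%R)%:E)%E @ \oo --> (0%E : \bar R).

(** [X] is an independent sequence of random variables on [0,1), the k-th one
    having density [g k]. *)
Definition indep_with_densities (R : realType) d (T : measurableType d)
    (P : probability T R) (X : nat -> {RV P >-> R}) (g : nat -> R -> R)
    : Prop :=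
  [/\ independent_RVs X,
      (forall k t, X k t \in `[0, 1[) &
      (forall k, has_density P (X k) (g k))].

(* Main.v *)
(** Take [f_k = e_k + (1 - e_k) / e_k * 1_[0, e_k]] with [e_k] summable.  For
    fixed [k], [f_k >= e_k] is Doeblin's minorization: if the law of a partial sum
    mod 1 dominates [c] times the uniform law, the next density is at least
    [e_k + c (1 - e_k)], so [1 - c] decays geometrically, and it controls the L^1
    distance to the uniform density.  When [X_k] has density [f_k], the event
    [X_k > e_k] has probability at most [e_k], so by a union bound all the [X_k]
    stay in [0, e_k], and every partial sum stays in [0, s], with probability
    at least [1 - s], where [s] is the sum of the [e_k]; for [s < 1/2] this
    concentration keeps the L^1 distance to uniform at least [1 - 2 s]. *)
Require Import Defs.
From HB Require Import structures.
From mathcomp Require Import all_boot all_order all_algebra.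
From mathcomp Require Import finmap.
From mathcomp Require Import all_classical all_reals all_analysis.
From mathcomp Require Import measurable_realfun.
From mathcomp Require Import ring lra.

Import Order.TTheory GRing.Theory Num.Theory.
Import numFieldNormedType.Exports.

Local Open Scope classical_set_scope.
Local Open Scope ring_scope.

Set Implicit Arguments.
Unset Strict Implicit.
Unset Printing Implicit Defensive.

(** * Fractional parts and the uniform law on the circle *)

Section frac.
Context {R : realType}.
Implicit Types (x y c : R) (A E : set R).
Local Notation mu := (@lebesgue_measure R).

Definition frac x : R := x - (Num.floor x)%:~R.

Lemma floor_add_frac x : (Num.floor x)%:~R + frac x = x.
Proof. by rewrite addrC subrK. Qed.

Lemma frac_itv x : 0 <= frac x < 1.
Proof.
rewrite /frac subr_ge0 floor_le /= ltrBlDr addrC.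
by have := floorD1_gt x; rewrite intrD.
Qed.

Lemma frac_id x : 0 <= x < 1 -> frac x = x.
Proof.
move=> /andP[x0 x1]; rewrite /frac (_ : Num.floor x = 0) ?subr0//.
by apply: floor_def; rewrite x0/= add0r.
Qed.

Lemma frac_addz x (n : int) : frac (x + n%:~R) = frac x.
Proof.
by rewrite /frac floorDrz ?intr_int// intrKfloor intrD; ring.
Qed.

Lemma frac_subz x (n : int) : frac (x - n%:~R) = frac x.
Proof. by rewrite -mulrNz frac_addz. Qed.

Lemma frac_addr x y : frac (x + frac y) = frac (x + y).
Proof. by rewrite {2}/frac addrA frac_subz. Qed.

Lemma frac_subr x y : frac (x - frac y) = frac (x - y).
Proof. by rewrite {2}/frac opprB addrA addrAC frac_addz. Qed.

Lemma frac_frac x : frac (frac x) = frac x.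
Proof. by rewrite -{1}[frac x]add0r frac_addr add0r. Qed.

Lemma measurable_frac : measurable_fun [set: R] frac.
Proof.
apply: measurable_funB => //; apply: nondecreasing_measurable => // x y xy.
by rewrite ler_int; exact: le_floor.
Qed.

(** Translation invariance, by uniqueness: a measure giving half-open intervals their length is
    Lebesgue measure. *)
Lemma lebesgue_measureD c A : measurable A ->
  pushforward mu (+%R c : R -> measurableTypeR R) A = mu A.
Proof.
move=> mA; apply/esym/lebesgue_measure_unique => //=.
  exact: (@measurable_funD _ (measurableTypeR R) _ _ (cst c) id).
move=> _ _ [[a b]] _ <-.
rewrite /pushforward (_ : +%R c @^-1` _ = `]a - c, b - c]%classic); last first.
  by apply/seteqP; split => x /=; rewrite !in_itv/= ltrBlDl lerBrDl.
rewrite !lebesgue_measure_itv/= !lte_fin ltrD2r.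
by case: ifPn => // _; rewrite -!EFinB; congr EFin; ring.
Qed.

Lemma measurable_addr_preimage c A : measurable A -> measurable (+%R c @^-1` A).
Proof.
move=> mA; rewrite -[X in measurable X]setTI.
have m : measurable_fun [set: R] (+%R c) by exact: measurable_funD.
exact: m.
Qed.

Lemma lebesgue_itv_shift c a b E : measurable E ->
  mu (`[a, b[ `&` (+%R c @^-1` E)) = mu (`[c + a, c + b[ `&` E).
Proof.
move=> mE; rewrite -[RHS](lebesgue_measureD c); last exact: measurableI.
rewrite /pushforward preimage_setI; congr (mu (_ `&` _)).
by apply/seteqP; split => x /=; rewrite !in_itv/= lerD2l ltrD2l.
Qed.

Lemma lebesgue_itv_cat a b c E : measurable E -> a <= b <= c ->
  mu (`[a, c[ `&` E) = (mu (`[a, b[ `&` E) + mu (`[b, c[ `&` E))%E.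
Proof.
move=> mE /andP[ab bc]; rewrite -measureU; last 3 first.
- exact: measurableI.
- exact: measurableI.
- apply/seteqP; split => x //= [[+ _] [+ _]]; rewrite !in_itv/= => /andP[_ xb].
  by move=> /andP[/le_lt_trans/(_ xb)]; rewrite ltxx.
rewrite -setIUl; congr (mu (_ `&` _)); apply/seteqP; split => x /=.
  by rewrite !in_itv/= => /andP[-> ->]; case: (ltP x b) => _; [left|right].
rewrite !in_itv/= => -[/andP[-> xb]|/andP[bx ->]].
  by rewrite (lt_le_trans xb bc).
by rewrite (le_trans ab bx).
Qed.

(** An integer shift reduces to a window starting at [frac c]; that window is cut at 1, and the
    piece beyond 1 is moved back by one period. *)
Lemma lebesgue_periodic c E : measurable E ->
    (forall n : int, +%R n%:~R @^-1` E = E) ->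
  mu (`[c, c + 1[ `&` E) = mu (`[0, 1[ `&` E).
Proof.
move=> mE pE; have [c0 c1] := andP (frac_itv c).
transitivity (mu (`[frac c, frac c + 1[ `&` E)).
  rewrite -[in RHS](pE (Num.floor c)) lebesgue_itv_shift//.
  by rewrite [X in `[_, X[]addrA floor_add_frac.
rewrite (@lebesgue_itv_cat _ 1)// ?(ltW c1)/= ?lerDr//.
rewrite (@lebesgue_itv_cat 0 (frac c) 1)// ?(ltW c1) ?c0// addeC; congr (_ + _)%E.
have := @lebesgue_itv_shift 1 0 (frac c) E mE.
by rewrite (pE 1) addr0 [1 + _]addrC => <-.
Qed.

(** The uniform law on [R/Z], carried by the representatives in [0, 1). *)
Definition circle : set (measurableTypeR R) -> \bar R :=
  mrestr (@lebesgue_measure R) (measurable_itv `[0%R, 1%R[).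
HB.instance Definition _ := Measure.on circle.

Lemma circle_fin : fin_num_fun circle.
Proof.
move=> A mA; rewrite ge0_fin_numE ?measure_ge0//.
apply: (@le_lt_trans _ _ (mu `[0, 1[)).
  apply: le_measure; rewrite ?inE//; exact: measurableI.
by rewrite lebesgue_measure_itv/= lte01 oppr0 adde0 ltry.
Qed.
HB.instance Definition _ := Measure_isFinite.Build _ _ _ circle circle_fin.

Lemma circle_setT : circle [set: R] = 1%E.
Proof.
by rewrite /circle /mrestr setTI lebesgue_measure_itv/= lte01 -EFinB subr0.
Qed.

Lemma integral_circle (f : R -> \bar R) A : measurable A ->
    measurable_fun [set: R] f -> (forall x, (0 <= f x)%E) ->
  (\int[circle]_(x in A) f x = \int[mu]_(x in A `&` `[0%R, 1%R[) f x)%E.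
Proof.
move=> mA mf f0; have mI : measurable (`[0%R, 1%R[ : set R) by exact: measurable_itv.
have mAI : measurable (A `&` `[0%R, 1%R[) by exact: measurableI.
have mAD : measurable (A `\` `[0%R, 1%R[) by exact: measurableD.
rewrite -{1}(setDUK (@subIsetl _ A `[0%R, 1%R[)) setDIr setDv set0U.
rewrite ge0_integral_setU//; last 2 first.
- exact: measurable_funTS.
- by apply/disj_setPS => x [[_ ?] []].
rewrite [X in (_ + X)%E]null_set_integral//; last 2 first.
- exact: measurable_funTS.
- by rewrite /= /circle /mrestr setDE -setIA setICl setI0 measure0.
rewrite adde0; apply: eq_measure_integral => B mB BA.
by rewrite /= /circle /mrestr setIidl// => x /BA[].
Qed.

Lemma frac_preimage_periodic A (n : int) : +%R n%:~R @^-1` (frac @^-1` A) = frac @^-1` A.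
Proof. by apply/seteqP; split => x; rewrite /preimage/= addrC frac_addz. Qed.

Lemma measurable_frac_preimage A : measurable A -> measurable (frac @^-1` A).
Proof. by move=> mA; rewrite -[X in measurable X]setTI; exact: measurable_frac. Qed.

(** Any unit window is a fundamental domain; translation invariance of [circle] follows by shifting
    the window. *)
Lemma circleE c A : measurable A ->
  circle A = mu (`[c, c + 1[ `&` frac @^-1` A).
Proof.
move=> mA; rewrite lebesgue_periodic; last 2 first.
- exact: measurable_frac_preimage.
- by move=> n; exact: frac_preimage_periodic.
rewrite /circle /mrestr setIC; congr (mu _).
apply/seteqP; split => x [/= x01]; move: (x01); rewrite in_itv/= => /frac_id.
  by rewrite /preimage/= => ->.
by rewrite /preimage/= => ->.
Qed.

Lemma circle_frac_add c A : measurable A ->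
  circle ((fun x => frac (c + x)) @^-1` A) = circle A.
Proof.
move=> mA; have mfA := measurable_frac_preimage mA.
have := @lebesgue_itv_shift c 0 1 _ mfA.
by rewrite addr0 -circleE// => <-; rewrite /circle /mrestr setIC.
Qed.

(** Negation maps [[0, 1[] to []-1, 0]], which is a unit window up to its endpoints. *)
Lemma circle_frac_sub c A : measurable A ->
  circle ((fun x => frac (c - x)) @^-1` A) = circle A.
Proof.
move=> mA; have mfA := measurable_frac_preimage mA.
have mcA : measurable (+%R c @^-1` (frac @^-1` A)).
  exact: measurable_addr_preimage.
transitivity (mu (`]-1, 0] `&` +%R c @^-1` (frac @^-1` A))).
  rewrite -[RHS]lebesgue_measureN; last exact: measurableI.
  rewrite /pushforward preimage_setI /circle /mrestr setIC; congr (mu (_ `&` _)).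
  by apply/seteqP; split => x /=; rewrite !in_itv/= oppr_le0 ltrN2 andbC.
have := @lebesgue_itv_shift c (-1) 0 _ mfA.
have -> : c + 0 = (c - 1) + 1 by rewrite addr0 subrK.
rewrite -circleE// => <-.
set F := _ @^-1` _.
(* Endpoints are null: whatever sides are chosen, the measure is the integral of the indicator over
   the open interval. *)
suff H b0 b1 : mu ([set` Interval (BSide b0 (-1)) (BSide b1 0)] `&` F) =
    (\int[mu]_(x in `](-1)%R, 0%R[) (\1_F x)%:E)%E by rewrite !H.
rewrite -(@integral_itv_bndoo _ _ _ _ b0 b1); last first.
  by apply/measurable_EFinP/measurable_indic.
by rewrite integral_indic// setIC.
Qed.

Lemma measurable_frac_sub c : measurable_fun [set: R] (fun x => frac (c - x)).
Proof.
apply: (measurableT_comp measurable_frac).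
exact: (@measurable_funB _ R R _ (cst c) id).
Qed.

Lemma measurable_frac_add c : measurable_fun [set: R] (fun x => frac (c + x)).
Proof.
apply: (measurableT_comp measurable_frac).
exact: (@measurable_funD _ R R _ (cst c) id).
Qed.

Lemma integral_circle_preserving (phi : R -> R) (f : R -> \bar R) :
    measurable_fun [set: R] phi ->
    (forall A, measurable A -> circle (phi @^-1` A) = circle A) ->
    measurable_fun [set: R] f -> (forall x, (0 <= f x)%E) ->
  (\int[circle]_x f (phi x) = \int[circle]_x f x)%E.
Proof.
move=> mphi phiE mf f0.
transitivity (\int[pushforward circle (phi : R -> measurableTypeR R)]_x f x)%E.
  by rewrite ge0_integral_pushforward// => y _; exact: f0.
by apply: eq_measure_integral => // A mA _; exact: phiE.
Qed.
End frac.

(** * Joint laws as product measures *)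

Section joint.
Context {R : realType} d (T : measurableType d).
Local Open Scope ereal_scope.

(** Rectangles determine a product measure. General measures are allowed because [m] will be a
    probability restricted to an event, hence not of mass 1. *)
Lemma measure_joint_preimage (m : {measure set T -> \bar R}) (U V : T -> R)
    (m1 m2 : {sigma_finite_measure set R -> \bar R}) :
    measurable_fun [set: T] U -> measurable_fun [set: T] V ->
    (forall A B, measurable A -> measurable B ->
      m (U @^-1` A `&` V @^-1` B) = m1 A * m2 B) ->
  forall C, measurable C -> m ((fun t => (U t, V t)) @^-1` C) = (m1 \x m2) C.
Proof.
move=> mU mV mE C mC; apply/esym.
have mUV := measurable_fun_pair mU mV.
exact: (@product_measure_unique _ _ _ _ _ m1 m2
  (pushforward m (fun t => (U t, V t)))).
Qed.

End joint.

(** * Independence of a partial sum and the next variable *)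

Section sums.
Context {R : realType} d (T : measurableType d) (P : probability T R).
Variable X : nat -> {RV P >-> R}.
Local Open Scope ereal_scope.

Definition partial_sum M t : R := (\sum_(k < M) X k t)%R.

Lemma measurable_partial_sum M : measurable_fun [set: T] (partial_sum M).
Proof. by apply: measurable_sum => k; exact: measurable_funP. Qed.
HB.instance Definition _ M :=
  isMeasurableFun.Build _ _ _ _ (partial_sum M) (measurable_partial_sum M).

Definition cylinder (J : {fset nat}) (A : nat -> set R) : set T :=
  \bigcap_(k in [set` J]) (X k @^-1` A k).

Lemma measurable_cylinder J A : (forall k, measurable (A k)) ->
  measurable (cylinder J A).
Proof.
move=> mA; apply: fin_bigcap_measurable => // k _.
exact: measurable_funPTI.
Qed.

Lemma cylinder1 M A : cylinder [fset M]%fset A = X M @^-1` A M.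
Proof. by rewrite /cylinder set_fset1 bigcap_set1. Qed.

Hypothesis indepX : independent_RVs X.

(** Carrying the future event [cylinder J B] along is what closes the induction
    on [M]: with [M] added to [J], it gives the joint law of [partial_sum M] and
    [X M] under [P] restricted to the event. *)
Lemma independent_partial_sum M (J : {fset nat}) A B :
    (forall k, k \in J -> (M <= k)%N) -> (forall k, measurable (B k)) ->
    measurable A ->
  P (partial_sum M @^-1` A `&` cylinder J B) =
  P (partial_sum M @^-1` A) * P (cylinder J B).
Proof.
elim: M J A B => [|M IH] J A B JM mB mA.
  rewrite (_ : _ @^-1` A = if 0%R \in A then setT else set0).
    by case: ifPn; rewrite ?setTI ?probability_setT ?mul1e// set0I measure0 mul0e.
  rewrite /partial_sum; apply/seteqP; split => t /=; rewrite big_ord0.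
    by move=> A0; rewrite mem_set.
  by case: ifPn => // /set_mem.
set E := cylinder J B; have mE : measurable E by exact: measurable_cylinder.
have PE : (fine (P E))%:E = P E by rewrite fineK// fin_num_measure.
have PE0 : (0 <= fine (P E))%R by exact: fine_ge0.
pose S := partial_sum M.
(* Under [P] restricted to [E], the pair [(S, X M)] has a product law; the total mass [P E] is
   attached to the first factor. *)
have jointE (A1 B1 : set R) : measurable A1 -> measurable B1 ->
    mrestr P mE (S @^-1` A1 `&` X M @^-1` B1) =
    mscale (NngNum PE0) (distribution P S) A1 * distribution P (X M) B1.
  move=> mA1 mB1; pose B' k := if k == M then B1 else B k.
  have mB' k : measurable (B' k) by rewrite /B'; case: ifP.
  (* Indices in [J] are at least [M + 1], so slot [M] is free and [X M] can join the future
     event. *)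
  have MJ : M \notin J by apply/negP => /JM; rewrite ltnn.
  have B'J k : k \in J -> B' k = B k.
    by move=> kJ; rewrite /B'; case: eqP => // kM; move: MJ; rewrite -kM kJ.
  have cylE : cylinder (M |` J)%fset B' = X M @^-1` B1 `&` E.
    rewrite /cylinder set_fsetU1 bigcap_setU1 /B' eqxx; congr (_ `&` _).
    by apply: eq_bigcapr => k kJ; rewrite -/(B' k) B'J.
  rewrite /mrestr -setIA -cylE IH//; last first.
    by move=> k; rewrite !inE => /orP[/eqP->//|/JM/ltnW].
  have PE' : \prod_(k <- J) P (X k @^-1` B' k) = P E.
    by rewrite [RHS]indepX//; apply: eq_big_seq => k kJ; rewrite B'J.
  rewrite [P (cylinder _ B')]indepX// big_fsetU1//= {1}/B' eqxx PE'.
  rewrite /mscale/= PE [in RHS](muleC (P E)) -[in RHS]muleA.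
  by congr (_ * _); rewrite muleC.
pose C := (fun z : R * R => (z.1 + z.2)%R) @^-1` A.
have mC : measurable C.
  rewrite /C -[X in measurable X]setTI.
  by apply: measurable_funD => //; exact: measurableT.
have SC : partial_sum M.+1 @^-1` A = (fun t => (S t, X M t)) @^-1` C.
  by apply/seteqP; split => t; rewrite /C /preimage/= /partial_sum big_ord_recr.
rewrite SC.
have mS : measurable_fun [set: T] S by exact: measurable_partial_sum.
have mX : measurable_fun [set: T] (X M) by exact: measurable_funP.
transitivity ((mscale (NngNum PE0) (distribution P S) \x distribution P (X M)) C).
  exact: (measure_joint_preimage mS mX jointE mC).
(* The unrestricted joint law comes from the induction hypothesis at [J = {M}]; the two product
   measures then differ by the factor [P E]. *)
rewrite [X in _ = X * _](measure_joint_preimage mS mX _ mC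
  (m1 := distribution P S) (m2 := distribution P (X M))); last first.
  move=> A1 B1 mA1 mB1.
  have := IH [fset M]%fset A1 (fun=> B1).
  rewrite cylinder1; apply => // k.
  by rewrite inE => /eqP ->.
rewrite /product_measure1/= ge0_integral_mscale//.
  by rewrite PE muleC.
exact: measurable_fun_xsection.
Qed.

Lemma partial_sum_joint M C : measurable C ->
  P ((fun t => (partial_sum M t, X M t)) @^-1` C) =
  (distribution P (partial_sum M) \x distribution P (X M)) C.
Proof.
move=> mC; apply: measure_joint_preimage => // A B mA mB.
have := @independent_partial_sum M [fset M]%fset A (fun=> B).
by rewrite cylinder1; apply => // k; rewrite inE => /eqP ->.
Qed.
End sums.

(** * Convolution on the circle and its lower bound *)

Section convolution.
Context {R : realType}.
Local Notation mu := (@lebesgue_measure R).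
Local Open Scope ereal_scope.

Lemma eq_integral_circle (f g : R -> \bar R) :
    measurable_fun [set: R] f -> measurable_fun [set: R] g ->
    (forall x, 0 <= f x) -> (forall x, 0 <= g x) ->
    (forall x, (0 <= x < 1)%R -> f x = g x) ->
  \int[circle]_x f x = \int[circle]_x g x.
Proof.
move=> mf mg f0 g0 fg; rewrite !integral_circle// setTI.
by apply: eq_integral => x; rewrite inE/= in_itv => /fg.
Qed.

Lemma integral_indicM d (T : measurableType d) (m : {measure set T -> \bar R})
    (A : set T) (f : T -> \bar R) :
  \int[m]_(x in A) f x = \int[m]_x (f x * (\1_A x)%:E).
Proof. by rewrite integral_mkcond epatch_indic. Qed.

Lemma integral_cstD d (T : measurableType d) (m : {measure set T -> \bar R})
    (a : R) (f : T -> \bar R) :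
    m setT = 1 -> (0 <= a)%R -> measurable_fun [set: T] f ->
    (forall x, 0 <= f x) ->
  \int[m]_x (a%:E + f x) = a%:E + \int[m]_x f x.
Proof.
move=> m1 a0 mf f0.
by rewrite ge0_integralD//= integral_cst// m1 mule1.
Qed.

Variables (m1 m2 : probability R R) (f : R -> R).
Hypothesis mf : measurable_fun [set: R] f.
Hypothesis f0 : (forall x, 0 <= f x)%R.
Hypothesis m2E : forall A, measurable A ->
  m2 A = \int[mu]_(x in A `&` `[0%R, 1%R[) (f x)%:E.

Lemma measurable_frac_kernel :
  measurable_fun [set: R * R] (fun z => (f (frac (z.2 - z.1)))%:E).
Proof.
apply/measurable_EFinP; apply: (measurableT_comp mf).
by apply: (measurableT_comp measurable_frac); exact: measurable_funB.
Qed.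

(** Tonelli plus the substitution [y = frac (z - x)]. As [m1] is arbitrary, a sum mod 1 has a
    density as soon as its last term has one. *)
Lemma convolution_frac A : measurable A ->
  (m1 \x m2) ((fun z => frac (z.1 + z.2)) @^-1` A) =
  \int[circle]_(z in A) \int[m1]_x (f (frac (z - x)))%:E.
Proof.
move=> mA.
have mI : measurable_fun [set: R] (\1_A : R -> R) by exact: measurable_indic.
(* The indicator of [A] enters the integrand so that Tonelli applies on the whole product. *)
pose G (z : R * R) := ((f (frac (z.2 - z.1)))%:E * (\1_A z.2 : R)%:E).
have mG : measurable_fun [set: R * R] G.
  apply: emeasurable_funM; first exact: measurable_frac_kernel.
  by apply/measurable_EFinP; apply: (measurableT_comp mI).
have G0 z : 0 <= G z by rewrite /G mule_ge0// lee_fin.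
rewrite [RHS]integral_indicM.
transitivity (\int[circle]_z \int[m1]_x G (x, z)); last first.
  apply: eq_integral => z _; rewrite /G/= ge0_integralZr//.
  - exact: (measurable_fun_pair1 z measurable_frac_kernel).
  - by move=> x _; rewrite lee_fin.
rewrite -(@fubini_tonelli _ _ _ _ _ m1 circle G mG G0).
rewrite /product_measure1/=; apply: eq_integral => x _.
have mAx : measurable ((fun y => frac (x + y)) @^-1` A).
  by rewrite -[X in measurable X]setTI; exact: measurable_frac_add.
have mff0 : measurable_fun [set: R] (fun y => f (frac y)).
  exact: (measurableT_comp mf measurable_frac).
have mIx : measurable_fun [set: R] (fun y => \1_A (frac (x + y)) : R).
  exact: (measurableT_comp mI (measurable_frac_add x)).
rewrite /= (_ : xsection _ x = (fun y => frac (x + y)) @^-1` A); last first.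
  by apply/seteqP; split => y; rewrite /xsection/= inE.
rewrite m2E// -(@integral_circle _ (EFin \o f))//; last exact/measurable_EFinP.
rewrite integral_indicM.
pose g y := ((f (frac y))%:E * (\1_A (frac (x + y)) : R)%:E).
have mg : measurable_fun [set: R] g.
  by apply: emeasurable_funM; exact/measurable_EFinP.
have g0 y : 0 <= g y by rewrite /g mule_ge0// lee_fin.
transitivity (\int[circle]_y g y).
  apply: eq_integral_circle => //.
  - by apply: emeasurable_funM; exact/measurable_EFinP.
  - by move=> y; rewrite mule_ge0// lee_fin.
  - by move=> y y01; rewrite /g frac_id.
(* Translation by [-x] preserves [circle] and turns [frac (x + y)] into [z] for [z] in [[0, 1)]. *)
rewrite -(@integral_circle_preserving _ (fun z => frac (- x + z)))//; last 2 first.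
- exact: measurable_frac_add.
- by move=> B mB; exact: circle_frac_add.
apply: eq_integral_circle => //.
- exact: (measurableT_comp mg (measurable_frac_add (- x))).
- exact: (measurable_fun_pair2 x mG).
- move=> y y01; rewrite /G /g/= frac_frac frac_addr addrA subrr add0r (frac_id y01).
  by rewrite [(y - x)%R]addrC.
Qed.

(** Split [f = a + (f - a)]: the constant part contributes [a] whatever [m1] is,
    and the nonnegative rest only sees the part [c circle] of [m1]. *)
Lemma convolution_frac_lb (a c : R) z :
    (0 <= a)%R -> (forall x, a <= f x)%R -> (0 <= c)%R ->
    \int[circle]_x (f x)%:E = 1 ->
    (forall A, measurable A -> c%:E * circle A <= m1 (frac @^-1` A)) ->
  (a + c * (1 - a))%:E <= \int[m1]_x (f (frac (z - x)))%:E.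
Proof.
move=> a0 af c0 f1 m1c.
have mg : measurable_fun [set: R] (fun x => (f x - a)%:E).
  by apply/measurable_EFinP; exact: measurable_funB.
have g0 x : 0 <= (f x - a)%:E by rewrite lee_fin subr_ge0.
have fE x : (f x)%:E = a%:E + (f x - a)%:E by rewrite -EFinD addrC subrK.
have circle_g : \int[circle]_x (f x - a)%:E = (1 - a)%:E.
  have : a%:E + \int[circle]_x (f x - a)%:E = 1%:E.
    rewrite -f1; under [RHS]eq_integral do rewrite fE.
    by rewrite integral_cstD//; exact: circle_setT.
  by case: (\int[_]_x _) => // r [] <-; congr EFin; ring.
have mgz : measurable_fun [set: R] (fun u => (f (frac (z - u)) - a)%:E).
  by apply: (measurableT_comp mg); exact: measurable_frac_sub.
(* The integrand depends on [x] only through [frac x], so [m1] can be replaced by its image on the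
   circle, which dominates [c] times [circle]. *)
pose nu := pushforward m1 (frac : R -> measurableTypeR R).
have -> : \int[m1]_x (f (frac (z - x)))%:E =
    a%:E + \int[nu]_u (f (frac (z - u)) - a)%:E.
  rewrite ge0_integral_pushforward//; last exact: measurable_frac.
  rewrite preimage_setT -integral_cstD//.
  - by apply: eq_integral => x _; rewrite fE/= frac_subr.
  - exact: probability_setT.
  - exact: (measurableT_comp mgz measurable_frac).
  - by move=> x; exact: g0.
rewrite EFinD leeD2l// EFinM -circle_g.
(* The reflection [u -> z - u] preserves [circle], so [f - a] keeps its mass [1 - a]. *)
rewrite -(@integral_circle_preserving _ _ _ (measurable_frac_sub z) (@circle_frac_sub _ z) mg g0).
rewrite -(@ge0_integral_mscale _ _ _ circle _ measurableT (NngNum c0) _ mgz)//.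
apply: ge0_le_measure_integral => //.
exact: measurable_frac.
Qed.
End convolution.

(** * Densities and their L^1 distance to uniform *)

Section densities.
Context {R : realType}.
Local Notation mu := (@lebesgue_measure R).
Local Open Scope ereal_scope.

(** The endpoint 1 is null; this passes from the closed interval of [prob_density] to [circle]. *)
Lemma integral_itv01_circle (g : R -> \bar R) :
    measurable_fun [set: R] g -> (forall x, 0 <= g x) ->
  \int[mu]_(x in `[0%R, 1%R]) g x = \int[circle]_x g x.
Proof.
move=> mg g0; rewrite integral_circle// setTI integral_itv_bndo_bndc//.
exact: measurable_funTS.
Qed.

Lemma prob_density_circle (h : R -> R) :
    measurable_fun [set: R] h -> (forall x, 0 <= h x)%R ->
  \int[circle]_x (h x)%:E = 1 -> prob_density h.
Proof.
move=> mh h0 h1; have mEh : measurable_fun [set: R] (EFin \o h).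
  exact/measurable_EFinP.
have h1' : \int[mu]_(x in `[0%R, 1%R]) (h x)%:E = 1.
  by rewrite integral_itv01_circle.
split => //; apply/integrableP; split; first exact: measurable_funTS.
under eq_integral => x _ do rewrite /= ger0_norm//.
by rewrite h1' ltry.
Qed.

(** Since [|h - 1| = 1 + h - 2 min(h, 1)] and [min(h, 1) >= c], integration gives [1 + 1 - 2 c]. *)
Lemma L1_dist_uniform_le (h : R -> R) (c : R) :
    measurable_fun [set: R] h -> (forall x, c <= h x)%R -> (0 <= c <= 1)%R ->
  \int[circle]_x (h x)%:E = 1 ->
  \int[mu]_(x in `[0%R, 1%R]) (`|h x - 1|%R)%:E <= (2 * (1 - c))%:E.
Proof.
move=> mh ch /andP[c0 c1] h1.
have mEh : measurable_fun [set: R] (EFin \o h) by exact/measurable_EFinP.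
have mh1 : measurable_fun [set: R] (fun x => (`|h x - 1|%R)%:E).
  apply/measurable_EFinP; apply: measurableT_comp => //.
  exact: measurable_funB.
have h0 x : (0 <= h x)%R by exact: le_trans (ch x).
rewrite integral_itv01_circle//.
(* [|h - 1| + 2 c <= 1 + h] pointwise, by [c <= h] and [c <= 1]. *)
have : (2 * c)%:E + \int[circle]_x (`|h x - 1|%R)%:E <= 1 + \int[circle]_x (h x)%:E.
  rewrite -!integral_cstD//; last 3 first.
  - exact: circle_setT.
  - exact: circle_setT.
  - by rewrite mulr_ge0.
  apply: ge0_le_integral => //.
  - by move=> x _; rewrite adde_ge0// lee_fin// mulr_ge0.
  - exact: emeasurable_funD.
  - exact: emeasurable_funD.
  - move=> x _; rewrite -!EFinD lee_fin; have := ch x.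
    by case: (ler0P (h x - 1)); lra.
rewrite h1 -leeBrDl// => /le_trans; apply.
rewrite (_ : _ - _ = (1 + 1 - 2 * c)%:E)// lee_fin.
lra.
Qed.

End densities.

(** * Convergence for a fixed density bounded below *)

Section minorized.
Context {R : realType} d (T : measurableType d) (P : probability T R).
Variables (X : nat -> {RV P >-> R}) (f : R -> R) (a K : R).
Hypothesis mf : measurable_fun [set: R] f.
Hypothesis a01 : (0 < a <= 1)%R.
Hypothesis fK : (forall x, a <= f x <= K)%R.
Hypothesis Xf : indep_with_densities X (fun=> f).
Local Notation mu := (@lebesgue_measure R).
Local Open Scope ereal_scope.


Let f0 x : (0 <= f x)%R.
Proof. by have /andP[+ _] := fK x; apply/le_trans/ltW; case/andP: a01. Qed.

Let f1 : \int[circle]_x (f x)%:E = 1.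
Proof.
have [_ _ /(_ 0%N)[[_ _ +] _]] := Xf.
rewrite integral_itv01_circle//; exact/measurable_EFinP.
Qed.

Let XE M A : measurable A -> distribution P (X M) A =
  \int[mu]_(x in A `&` `[0%R, 1%R[) (f x)%:E.
Proof. by move=> mA; have [_ _ /(_ M)[_ /(_ _ mA)]] := Xf. Qed.

(** Density of the sum of [M + 1] variables mod 1: the law of the first [M] convolved with [f]. The
    index is thus one behind the number of terms. *)
Definition sum_density M z :=
  \int[distribution P (partial_sum X M)]_x (f (frac (z - x)))%:E.

Lemma sum_density_law M A : measurable A ->
  P ((frac \o partial_sum X M.+1) @^-1` A) =
  \int[circle]_(z in A) sum_density M z.
Proof.
move=> mA; have [indX _ _] := Xf.
rewrite -(convolution_frac (distribution P (partial_sum X M)) mf f0 (XE M) mA).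
rewrite -partial_sum_joint//; last first.
  rewrite -[X in measurable X]setTI.
  apply: (measurableT_comp measurable_frac) => //.
  exact: measurable_funD.
congr (P _).
by apply/seteqP; split => t; rewrite /preimage/= /partial_sum big_ord_recr.
Qed.

Lemma sum_density_ge0 M z : 0 <= sum_density M z.
Proof. by apply: integral_ge0 => x _; rewrite lee_fin. Qed.

Lemma measurable_sum_density M : measurable_fun [set: R] (sum_density M).
Proof.
have k0 (z : R * R) : 0 <= (f (frac (z.2 - z.1)))%:E by rewrite lee_fin.
exact: (@measurable_fun_fubini_tonelli_G _ _ _ _ _
  (distribution P (partial_sum X M)) _ (measurable_frac_kernel mf) k0).
Qed.

(** The bound [K] serves here, so that taking [fine] loses nothing. *)
Lemma sum_density_fin M z : sum_density M z \is a fin_num.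
Proof.
rewrite ge0_fin_numE ?sum_density_ge0//.
apply: (@le_lt_trans _ _ (\int[distribution P (partial_sum X M)]_x K%:E)).
  apply: ge0_le_integral => //.
  - by move=> x _; rewrite lee_fin.
  - exact: (measurable_fun_pair1 z (measurable_frac_kernel mf)).
  - by move=> x _; rewrite lee_fin; case/andP: (fK (frac (z - x))).
by rewrite integral_cst//= probability_setT mule1 ltry.
Qed.

(** Each step replaces the constant [c] by [a + c (1 - a)], that is, multiplies [1 - c] by
    [1 - a]. *)
Lemma sum_density_lb M z : (1 - (1 - a) ^+ M.+1)%:E <= sum_density M z.
Proof.
have [a0 a1] := andP a01.
have step N c : (0 <= c)%R -> (forall A, measurable A ->
      c%:E * circle A <= P ((frac \o partial_sum X N) @^-1` A)) ->
    forall u, (a + c * (1 - a))%:E <= sum_density N u.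
  move=> c0 Nc u; apply: convolution_frac_lb => //; first exact: ltW.
  by move=> x; case/andP: (fK x).
elim: M z => [|M IH] z.
  (* The empty sum is a point mass, so the recursion starts from [c = 0]. *)
  have := @step 0%N 0%R (lexx _) _ z; rewrite mul0r addr0 expr1 subKr.
  by apply => A mA; rewrite mul0e measure_ge0.
have -> : (1 - (1 - a) ^+ M.+2 = a + (1 - (1 - a) ^+ M.+1) * (1 - a))%R.
  by rewrite exprSr; ring.
apply: step => [|A mA]; first by rewrite subr_ge0 exprn_ile1; lra.
(* Integrating the pointwise bound over [A] gives the setwise domination that [step] requires. *)
rewrite sum_density_law// -integral_cst//.
apply: ge0_le_integral => //.
- by move=> x _; rewrite lee_fin subr_ge0 exprn_ile1; lra.
- by apply: measurable_funTS; exact: measurable_sum_density.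
Qed.

Lemma cvg_to_uniform_minorized : cvg_to_uniform X.
Proof.
have [a0 a1] := andP a01.
(* The value at [M = 0] is a placeholder: a density is required only for [M > 0]. *)
pose h M z : R := if M is M'.+1 then fine (sum_density M' z) else 1%R.
have mh M : measurable_fun [set: R] (h M.+1).
  by apply: measurableT_comp => //; exact: measurable_sum_density.
have hE M : EFin \o h M.+1 = sum_density M.
  by apply/funext => z; rewrite /= fineK// sum_density_fin.
have h0 M z : (0 <= h M.+1 z)%R by rewrite /h fine_ge0// sum_density_ge0.
have h1 M : \int[circle]_z (EFin \o h M.+1) z = 1.
  rewrite hE.
  by rewrite -sum_density_law// preimage_setT probability_setT.
exists h; split.
  move=> [//|M] _; split; first exact: (prob_density_circle (mh M) (h0 M) (h1 M)).
  move=> A mA; rewrite /pushforward.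
  rewrite (_ : sum_mod1 X M.+1 = frac \o partial_sum X M.+1)//.
  rewrite sum_density_law// integral_circle//.
  - by rewrite -hE.
  - exact: measurable_sum_density.
  - exact: sum_density_ge0.
pose e M : R := (2 * (1 - a) * (1 - a) ^+ M)%R.
have he M : 0 <= \int[mu]_(x in `[0%R, 1%R]) (`|h M.+1 x - 1|%R)%:E <= (e M)%:E.
  apply/andP; split; first by apply: integral_ge0 => x _; rewrite lee_fin.
  have hc z : (1 - (1 - a) ^+ M.+1 <= h M.+1 z)%R.
    by rewrite -lee_fin; have := sum_density_lb M z; rewrite -hE.
  have c01 : (0 <= 1 - (1 - a) ^+ M.+1 <= 1)%R.
    rewrite subr_ge0 exprn_ile1/=; [|lra|lra].
    by rewrite lerBlDr lerDl exprn_ge0//; lra.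
  apply: le_trans (L1_dist_uniform_le (mh M) hc c01 (h1 M)) _.
  by rewrite lee_fin /e exprS; lra.
have ecvg : (e M)%:E @[M --> \oo] --> 0.
  apply: cvg_EFin; first exact: nearW.
  by apply: cvg_geometric; rewrite ger0_norm; lra.
have : \int[mu]_(x in `[0%R, 1%R]) (`|h M.+1 x - 1|%R)%:E @[M --> \oo] --> 0.
  by apply: (squeeze_cvge _ (cvg_cst 0) ecvg); exact: nearW.
(* Dropping the placeholder index 0 does not affect the limit. *)
by rewrite -[X in _ -> X]cvg_shiftS.
Qed.
End minorized.

(** * The explicit densities *)

Section bump.
Context {R : realType}.
Implicit Types (e x : R).
Local Notation mu := (@lebesgue_measure R).

(** The height [(1 - e) / e] on [0, e] makes the total mass [1]. *)
Definition bump e x : R := e + (1 - e) / e * \1_(`[0, e]) x.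

Lemma measurable_bump e : measurable_fun [set: R] (bump e).
Proof.
apply: measurable_funD => //; apply: measurable_funM => //.
Qed.

Lemma bump_bounds e x : 0 < e < 1 -> e <= bump e x <= e + (1 - e) / e.
Proof.
move=> /andP[e0 e1]; rewrite /bump lerDl lerD2l indicE.
have k0 : 0 <= (1 - e) / e by apply: divr_ge0; lra.
by case: (_ \in _); rewrite ?mulr1 ?mulr0 ?lexx k0.
Qed.

Lemma bump_out e x : e < x -> bump e x = e.
Proof.
move=> ex; rewrite /bump indicE memNset ?mulr0 ?addr0//=.
by rewrite in_itv/= => /andP[_]; rewrite leNgt ex.
Qed.

Lemma integral_bump e : 0 < e < 1 -> (\int[circle]_x (bump e x)%:E = 1)%E.
Proof.
move=> /andP[e0 e1]; have k0 : 0 <= (1 - e) / e by apply: divr_ge0; lra.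
have mI : measurable_fun [set: R] (\1_(`[0, e]) : R -> R).
  exact: measurable_indic.
have circle_e : circle (`[0, e] : set R) = e%:E.
  rewrite /circle /mrestr setIidl.
    by rewrite lebesgue_measure_itv/= lte_fin e0 oppr0 adde0.
  by move=> x /=; rewrite !in_itv/= => /andP[-> /le_lt_trans]; exact.
under eq_integral do rewrite /bump EFinD EFinM.
rewrite integral_cstD//.
- rewrite ge0_integralZl_EFin//; last exact/measurable_EFinP.
  rewrite integral_indic//= setIT circle_e -EFinM -EFinD.
  by rewrite divfK ?gt_eqF//; congr EFin; lra.
- exact: circle_setT.
- exact: ltW.
- by apply/measurable_EFinP; exact: measurable_funM.
- by move=> x; rewrite -EFinM lee_fin mulr_ge0.
Qed.

Lemma prob_density_bump e : 0 < e < 1 -> prob_density (bump e).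
Proof.
move=> e01; apply: prob_density_circle (integral_bump e01).
- exact: measurable_bump.
- by move=> x; have /andP[+ _] := bump_bounds x e01; apply: le_trans; lra.
Qed.

(** Beyond [max(e, e')] the two functions are the distinct constants [e] and [e'], so a set of
    positive length would lie in the exceptional null set. *)
Lemma bump_not_same_L1 e e' : 0 < e < 1 -> 0 < e' < 1 -> e != e' ->
  ~ same_L1 (bump e) (bump e').
Proof.
move=> /andP[e0 e1] /andP[e'0 e'1] ee' [N [mN N0 subN]].
pose m := Num.max e e'.
have m1 : m < 1 by rewrite gt_max e1.
have sub : `]m, 1] `<=` N.
  move=> x /=; rewrite in_itv/= gt_max => /andP[/andP[ex e'x] x1].
  apply: subN => /=; rewrite !bump_out// in_itv/= x1 (le_trans (ltW e0) (ltW ex)).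
  by move=> /(_ isT); apply/eqP.
have : (mu (`]m, 1%R] : set R) <= mu N)%E by apply: le_measure; rewrite ?inE.
by rewrite N0 lebesgue_measure_itv/= lte_fin m1 -EFinB lee_fin; lra.
Qed.

(** Off [[0, e]] the density is the constant [e], integrated over a set of [circle] measure at most
    1. *)
Lemma bump_tail d (T : measurableType d) (P : probability T R)
    (Y : {RV P >-> R}) e : 0 < e < 1 -> has_density P Y (bump e) ->
  (P (Y @^-1` (~` `[0%R, e])) <= e%:E)%E.
Proof.
move=> e01 [_ Yd]; have [e0 _] := andP e01.
have mC : measurable (~` `[0, e]%classic : set R) by exact: measurableC.
have := Yd _ mC; rewrite /pushforward => ->.
rewrite -(@integral_circle _ (EFin \o bump e))//; last 2 first.
- by apply/measurable_EFinP; exact: measurable_bump.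
- move=> x /=; rewrite lee_fin.
  by have /andP[+ _] := bump_bounds x e01; apply: le_trans; lra.
rewrite (eq_integral (cst e%:E)) => [|x].
  rewrite integral_cst//= -[leRHS]mule1; apply: lee_wpmul2l.
    by rewrite lee_fin ltW.
  rewrite -[leRHS]circle_setT; apply: le_measure; rewrite ?inE//.
by rewrite inE/= => xC; rewrite /bump indicE memNset ?mulr0 ?addr0//.
Qed.

End bump.

(** * Non-convergence for the varying densities *)

Section divergent.
Context {R : realType} d (T : measurableType d) (P : probability T R).
Variables (X : nat -> {RV P >-> R}) (e : nat -> R) (s : R).
Hypothesis s_lt : 0 < s < 1 / 2.
Hypothesis e_gt0 : forall k, 0 < e k < 1.
Hypothesis sum_e : forall M, \sum_(k < M) e k <= s.
Hypothesis Xe : indep_with_densities X (fun k => bump (e k)).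
Local Notation mu := (@lebesgue_measure R).
Local Open Scope ereal_scope.

Lemma prob_sum_mod1_small M : (1 - s)%:E <= P (sum_mod1 X M @^-1` `[0%R, s]).
Proof.
have [s0 s1] := andP s_lt; have [_ _ Xd] := Xe.
have mX (k : nat) (A : set R) : measurable A -> measurable (X k @^-1` A).
  by move=> mA; exact: measurable_funPTI.
pose B k := X k @^-1` (~` `[0%R, e k]).
have mB k : measurable (B k) by apply: mX; exact: measurableC.
have mBM : measurable (\big[setU/set0]_(k < M) B k) by exact: bigsetU_measurable.
have mS : measurable (sum_mod1 X M @^-1` `[0%R, s]).
  rewrite -[X in measurable X]setTI.
  by apply: (measurableT_comp measurable_frac (measurable_partial_sum X M)).
have sub : ~` (\big[setU/set0]_(k < M) B k) `<=` sum_mod1 X M @^-1` `[0%R, s].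
  move=> t; rewrite -bigcup_mkord => NB.
  have Xt k : (k < M)%N -> (0 <= X k t <= e k)%R.
    move=> kM; apply: contrapT => Xkt; by apply: NB; exists k.
  have S0 : (0 <= \sum_(k < M) X k t)%R.
    by apply: sumr_ge0 => k _; have /andP[] := Xt k (ltn_ord k).
  have Ss : (\sum_(k < M) X k t <= s)%R.
    apply: le_trans (sum_e M); apply: ler_sum => k _.
    by have /andP[] := Xt k (ltn_ord k).
  rewrite /preimage/= (_ : sum_mod1 X M t = frac (\sum_(k < M) X k t))//.
  (* Since [s < 1], reduction mod 1 leaves the sum unchanged. *)
  by rewrite frac_id ?in_itv/= ?S0//=; lra.
apply: le_trans (le_measure P _ _ sub); rewrite ?inE//; last exact: measurableC.
rewrite [leRHS]probability_setC// EFinB leeB//.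
apply: (le_trans (Boole_inequality _ _)) => //.
apply: (@le_trans _ _ (\sum_(k < M) (e k)%:E)).
  by apply: lee_sum => k _; exact: bump_tail.
by rewrite sumEFin lee_fin.
Qed.

(** The interval [[0, s]] has mass at least [1 - s] under [h] but only length [s]. *)
Lemma L1_dist_uniform_ge h M : has_density P (sum_mod1 X M) h ->
  (1 - s - s)%:E <= \int[mu]_(x in `[0%R, 1%R]) (`|h x - 1|%R)%:E.
Proof.
move=> [[hint h0 h1] hd]; have [s0 s1] := andP s_lt.
have sub01 : `[0%R, s] `<=` `[0%R, 1%R].
  by move=> x /=; rewrite !in_itv/= => /andP[-> xs]/=; lra.
have mD1 : measurable (`[0%R, 1%R] : set R) by exact: measurable_itv.
have mDs : measurable (`[0%R, s] : set R) by exact: measurable_itv.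
(* An arbitrary density [h] is known to be measurable only on [[0, 1]]. *)
have mEh : measurable_fun (`[0%R, 1%R] : set R) (EFin \o h) by exact: measurable_int hint.
have mh : measurable_fun (`[0%R, 1%R] : set R) h by exact/measurable_EFinP.
have mh1 : measurable_fun (`[0%R, 1%R] : set R) (fun x => (`|h x - 1|%R)%:E).
  apply/measurable_EFinP; apply: measurableT_comp => //.
  exact: measurable_funB.
have := prob_sum_mod1_small M.
have := hd _ mDs; rewrite /pushforward => ->.
rewrite setIidl; last first.
  by move=> x /=; rewrite !in_itv/= => /andP[-> xs] /=; lra.
move=> hs; rewrite EFinB leeBlDr//; apply: (le_trans hs).
(* Pointwise [h <= |h - 1| + 1], and the constant 1 contributes [s]. *)
apply: (@le_trans _ _ (\int[mu]_(x in `[0%R, s]) ((`|h x - 1|%R)%:E + 1))).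
  apply: ge0_le_integral => //.
  - by move=> x /sub01 x01; rewrite lee_fin h0.
  - exact: measurable_funS mEh.
  - by apply: emeasurable_funD => //; exact: measurable_funS mh1.
  - by move=> x _; rewrite -EFinD lee_fin -lerBlDr ler_norm.
rewrite ge0_integralD//; last exact: measurable_funS mh1.
rewrite integral_cst//= lebesgue_measure_itv/= lte_fin s0 oppr0 adde0 mul1e.
rewrite leeD2r//; apply: ge0_subset_integral => //.
Qed.

Lemma not_cvg_to_uniform_bump : ~ cvg_to_uniform X.
Proof.
move=> [h [hd hcvg]]; have [s0 s1] := andP s_lt.
have : (1 - s - s)%:E <= 0.
  apply: (cvge_to_ge hcvg); near=> M.
  apply: (L1_dist_uniform_ge (hd M _)).
  (* Only [M > 0] is needed, as [hd] says nothing about the empty sum. *)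
  by near: M; exact: nbhs_infty_gt.
by rewrite lee_fin; lra.
Unshelve. all: by end_near.
Qed.

End divergent.

(** * Choice of the parameters and conclusion *)

Theorem mainTheorem4 (R : realType) :
  exists f : nat -> R -> R,
    [/\ (forall i, prob_density (f i)),
        (forall i j, i <> j -> ~ same_L1 (f i) (f j)),
        (forall i (d : measure_display) (T : measurableType d)
                (P : probability T R) (X : nat -> {RV P >-> R}),
            indep_with_densities X (fun _ => f i) -> cvg_to_uniform X) &
        (forall (d : measure_display) (T : measurableType d)
                (P : probability T R) (X : nat -> {RV P >-> R}),
            indep_with_densities X f -> ~ cvg_to_uniform X)].
Proof.
(* The shift by 3 makes the total [1/4], below the threshold [1/2] for [s]. *)
pose e k : R := 2^-1 ^+ (k + 3).
have e01 k : 0 < e k < 1 by rewrite exprn_gt0//= exprn_ilt1 ?addn3//; lra.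
have sum_e M : \sum_(k < M) e k <= 4^-1.
  (* The bound alone is not inductive; the exact geometric sum is. *)
  suff -> : \sum_(k < M) e k = 4^-1 - 2 * e M.
    by rewrite lerBlDr lerDl mulr_ge0//; have /andP[/ltW] := e01 M.
  elim: M => [|M IH]; first by rewrite big_ord0 /e; field.
  by rewrite big_ord_recr/= IH /e addSn exprS; field.
exists (fun k => bump (e k)); split.
- by move=> i; exact: prob_density_bump.
- move=> i j ij; apply: bump_not_same_L1 => //; apply/eqP => eij; apply: ij.
  by apply/(@addIn 3)/(@ieexprIn _ (2^-1 : R)) => //; rewrite lt_eqF//; lra.
- move=> i d T P X; apply: (@cvg_to_uniform_minorized _ _ _ _ _ _ (e i)).
  + exact: measurable_bump.
  + by have /andP[-> /ltW] := e01 i.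
  + by move=> x; exact: bump_bounds.
- move=> d T P X; apply: (@not_cvg_to_uniform_bump _ _ _ _ _ _ 4^-1) => //.
  by apply/andP; split; lra.
Qed.
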